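(* Let $(X,d)$ be a compact metric space and let $R_{\mathfrak X}=(X_j,f_j)_{1\le j\le n}$ be a contractive local IFS on $X$ with (non-empty) local attractor $A_{\mathfrak X}$. Then there exists a subset $\Omega^e(\mathfrak X)\subset(X\times\{0,1,\dots,n\})^{\mathbb Z}$ such that: (1) $\pi_{\Sigma^-}(\Omega^e(\mathfrak X))=\Sigma^-_{\mathfrak X}$; (2) $\pi_{0,X}(\Omega^e(\mathfrak X))=A_{\mathfrak X}$; in particular $\Omega^e(\mathfrak X)\ne\emptyset$; (3) $\sigma^{-1}$ maps $\Omega^e(\mathfrak X)$ into itself and, on $\Omega^e(\mathfrak X)$, $$(\pi_{1,X}\times\pi_{\Sigma^-})\circ\sigma^{-1}=S\circ(\pi_{-1,X}\times\pi_{\Sigma^-}),$$ where $S(x,\underline b)=(f_{b_{-1}}(x),\sigma^-(\underline b))$ takes values in $X\times\Sigma^-$ (and is defined at $(x,\underline b)\in X\times\Sigma^-$ when $x\in X_{b_{-1}}$; the identity includes the assertion that it is defined at the points where it is evaluated).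
   Context: A local IFS on a compact metric space $(X,d)$ is a family $R_{\mathfrak X}=(X_j,f_j)_{1\le j\le n}$ with $n\ge 2$, where $X_1,\dots,X_n$ are closed subsets of $X$ and each $f_j:X_j\to X$ is continuous. It is contractive if for each $j$ there is $\lambda_j\in[0,1)$ with $d(f_j(x),f_j(y))\le\lambda_j d(x,y)$ for all $x,y\in X_j$. The local Hutchinson-Barnsley operator is $F_{\mathfrak X}(B)=\bigcup_{1\le j\le n}f_j(B\cap X_j)$ for $B\subseteq X$; $A_{\mathfrak X}$ denotes the largest (for inclusion) set $B\subseteq X$ with $F_{\mathfrak X}(B)=B$, and is called the local attractor when it is non-empty. $\Sigma^-=\{1,\dots,n\}^{-\mathbb N}$ is the set of sequences $\underline b=(\dots,b_{-2},b_{-1})$, and $\sigma^-(\dots,b_{-3},b_{-2},b_{-1})=(\dots,b_{-3},b_{-2})$. For $\underline b\in\Sigma^-$ and $k\ge1$, $V_{[\underline b]_k}=f_{b_{-1}}\circ\cdots\circ f_{b_{-k}}(X_{b_{-k}})$, where by convention $f_i(A):=f_i(A\cap X_i)$ for $A\subseteq X$. The local code space is $\Sigma^-_{\mathfrak X}=\{\underline b\in\Sigma^-:\bigcap_{k\ge1}V_{[\underline b]_k}\neq\emptyset\}$. For $\omega=((x_k,a_k))_{k\in\mathbb Z}\in(X\times\{0,1,\dots,n\})^{\mathbb Z}$: $\pi_{k,X}(\omega)=x_k$ for $k\in\mathbb Z$; $\pi_{\Sigma^-}(\omega)=(\dots,a_{-2},a_{-1})\in\{0,1,\dots,n\}^{-\mathbb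 N}$ (here $\Sigma^-\subset\{0,1,\dots,n\}^{-\mathbb N}$); and $\sigma$ is the two-sided shift, $\sigma(\omega)=((x_{k+1},a_{k+1}))_{k\in\mathbb Z}$, with inverse $\sigma^{-1}(\omega)=((x_{k-1},a_{k-1}))_{k\in\mathbb Z}$. For maps $p,q$ with the same domain, $(p\times q)(\omega)=(p(\omega),q(\omega))$. *)

(* Defs.v *)
From mathcomp Require Import all_boot all_order all_algebra.
From mathcomp Require Import all_classical all_reals all_analysis.

Set Implicit Arguments.
Unset Strict Implicit.
Unset Printing Implicit Defensive.

Import Order.TTheory GRing.Theory Num.Theory.
Local Open Scope classical_set_scope.
Local Open Scope ring_scope.

(* The index set {1, ..., n} is 'I_n.  The partial map f_j : X_j -> X is the
   restriction to [ifs_dom j] of the total function [ifs_map j]; the values of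
   the latter outside [ifs_dom j] are never used. *)
Record localIFS (R : realType) (X : metricType R) (n : nat) := LocalIFS {
  ifs_dom : 'I_n -> set X ;
  ifs_map : 'I_n -> X -> X ;
  ifs_dom_closed : forall j, closed (ifs_dom j) ;
  ifs_map_continuous : forall j, {within ifs_dom j, continuous (ifs_map j)}
}.

(* {1, ..., n}^{-N}: the entry b_{-k} of the sequence, k >= 1, is [b k.-1]. *)
Definition codeseq (n : nat) := nat -> 'I_n.

(* {0, 1, ..., n}^{-N}, with the same indexing. *)
Definition codeseq0 (n : nat) := nat -> 'I_n.+1.

(* The inclusion of {1, ..., n}^{-N} in {0, 1, ..., n}^{-N}: [lift ord0] sends
   the j-th element of 'I_n (of value j - 1) to the element of value j. *)
Definition code_incl (n : nat) (b : codeseq n) : codeseq0 n :=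
  fun k => lift ord0 (b k).

Definition code_shift (n : nat) (b : codeseq n) : codeseq n := fun k => b k.+1.

Section LocalIFS.
Context {R : realType} {X : metricType R} {n : nat}.
Implicit Types (I : localIFS X n) (A B : set X) (b : codeseq n).

Definition contractive I : Prop :=
  forall j, exists lambda : R, [/\ 0 <= lambda, lambda < 1 &
    forall x y, ifs_dom I j x -> ifs_dom I j y ->
      mdist (ifs_map I j x) (ifs_map I j y) <= lambda * mdist x y].

(* The convention f_j(B) := f_j(B `&` X_j). *)
Definition ifs_image I (j : 'I_n) B : set X :=
  ifs_map I j @` (B `&` ifs_dom I j).

Definition hutchinson I B : set X :=
  \bigcup_(j in [set: 'I_n]) ifs_image I j B.

Definition is_largest_invariant I A : Prop :=
  hutchinson I A = A /\ forall B, hutchinson I B = B -> B `<=` A.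

Definition is_local_attractor I A : Prop :=
  is_largest_invariant I A /\ A !=set0.

Lemma largest_invariant_exists I : exists A, is_largest_invariant I A.
Proof.
exists (\bigcup_(B in [set B | hutchinson I B = B]) B); split; last first.
  by move=> B hB x Bx; exists B.
apply/seteqP; split=> x.
  case=> j _ [y [[B hB By] jy] <-]; exists B => //.
  by rewrite -hB; exists j => //; exists y.
case=> B hB; rewrite -{1}hB => -[j _ [y [By jy] <-]].
by exists j => //; exists y => //; split=> //; exists B.
Qed.

(* For k >= 1, f_{b_{-1}} o ... o f_{b_{-k}} (X_{b_{-k}}). *)
Definition cylinder I b (k : nat) : set X :=
  foldr (ifs_image I) (ifs_dom I (b k.-1)) (mkseq b k).

Definition local_code_space I : set (codeseq n) :=
  [set b | \bigcap_(k in [set k | (1 <= k)%N]) cylinder I b k !=set0].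

(* S is the partial map on X * {1, ..., n}^{-N} given by [skew_map] on the
   domain of definition [skew_dom]. *)
Definition skew_dom I : set (X * codeseq n) :=
  [set z | ifs_dom I (z.2 0%N) z.1].

Definition skew_map I (z : X * codeseq n) : X * codeseq n :=
  (ifs_map I (z.2 0%N) z.1, code_shift z.2).

End LocalIFS.

Definition bisequence (X : Type) (n : nat) := int -> X * 'I_n.+1.

Definition prod_map (T U V : Type) (p : T -> U) (q : T -> V) : T -> U * V :=
  fun t => (p t, q t).

Section BiSequences.
Context {X : Type} {n : nat}.

Implicit Type w : bisequence X n.

Definition pi_X (k : int) w : X := (w k).1.

Definition pi_code w : codeseq0 n := fun k => (w (- k.+1%:Z)).2.

Definition bishift_inv w : bisequence X n := fun k => w (k - 1).

Definition prod_code_incl (z : X * codeseq n) : X * codeseq0 n :=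
  (z.1, code_incl z.2).

End BiSequences.

(* Main.v *)
Require Import Defs.
From mathcomp Require Import all_boot all_order all_algebra.
From mathcomp Require Import all_classical all_reals all_analysis.

Set Implicit Arguments.
Unset Strict Implicit.
Unset Printing Implicit Defensive.

Import Order.TTheory GRing.Theory Num.Theory.
Local Open Scope classical_set_scope.
Local Open Scope ring_scope.

(** The set Omega consists of the bisequences whose strictly past symbols are
    all nonzero and whose past points form a backward orbit of the local IFS:
    x_{-m-1} lies in X_{b_{-m-1}} and is sent to x_{-m} by f_{b_{-m-1}}, for
    every m >= 0.  The coordinates of positive index, and the symbol a_0, are
    left free, so that Omega is stable under the inverse shift, and the
    semiconjugacy with S is the orbit relation at m = 0.

    The points x_0 that start a backward orbit form the largest invariant set.
    They form an invariant set because a backward orbit can be extended by one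
    step or truncated by one step; every invariant set consists of such points
    by dependent choice ([invariant_backward_orbit]).

    A code b occurs in Omega exactly when it is in the local code space.  If b
    is the code of a backward orbit, then x_0 lies in all cylinders of b.
    Conversely, a point y in all cylinders of b has a preimage under f_{b_{-1}}
    in all cylinders of the shifted code ([cylinders_preimage]), because the
    preimages of y in these cylinders form a decreasing sequence of nonempty
    compact sets; iterating produces a backward orbit with code b. *)

Lemma nested_compact_bigcap_neq0 (T : topologicalType) (C : nat -> set T) :
  compact (C 0%N) -> (forall k, closed (C k)) ->
  (forall k, C k.+1 `<=` C k) -> (forall k, C k !=set0) ->
  \bigcap_k C k !=set0.
Proof.
move=> compC0 closedC decrC /choice[u Cu].
have uC k m : (k <= m)%N -> C k (u m).
  move=> /subnK <-; move: (u _) (Cu (m - k + k)%N).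
  by elim: (m - k)%N => // d IH t; rewrite addSn => /decrC; exact: IH.
have tailC k : (u @ \oo) (C k) by exists k => // m /= /uC.
(* A cluster point of u lies in every closed set containing a tail of u. *)
have [p [_ clp]] := compC0 (u @ \oo) _ (tailC 0%N).
exists p => k _; apply: closedC => B pB; exact: clp.
Qed.

Section BackwardOrbits.
Context {R : realType} {X : metricType R} {n : nat}.
Implicit Types (I : localIFS X n) (A B : set X) (b : codeseq n) (x : nat -> X).

(** A backward orbit of the local IFS with code [b], starting at [x 0].  The
    point [x m] stands for x_{-m}; since b_{-m-1} is [b m], the map that
    leads from x_{-m-1} to x_{-m} has index [b m]. *)
Definition backward_orbit I b x : Prop :=
  forall m, ifs_dom I (b m) (x m.+1) /\ ifs_map I (b m) (x m.+1) = x m.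

Lemma backward_orbit_shift I b x :
  backward_orbit I b x -> backward_orbit I (code_shift b) (x \o S).
Proof. by move=> orb m; exact: (orb m.+1). Qed.

Lemma backward_orbit_extend I b x j :
  backward_orbit I b x -> ifs_dom I j (x 0%N) ->
  backward_orbit I (fun m => if m is m'.+1 then b m' else j)
    (fun m => if m is m'.+1 then x m' else ifs_map I j (x 0%N)).
Proof. by move=> orb jx [|m] //; exact: orb. Qed.

(** Each point of an invariant set is the image of a point of that set, so
    preimages can be chosen recursively without leaving it. *)
Lemma invariant_backward_orbit I A a : hutchinson I A = A -> A a ->
  exists b x, backward_orbit I b x /\ x 0%N = a.
Proof.
move=> FA Aa.
have step (z : {z : X | A z}) : {t : 'I_n * {z : X | A z} |
    ifs_dom I t.1 (sval t.2) /\ ifs_map I t.1 (sval t.2) = sval z}.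
  apply: cid; case: z => z Az /=.
  move: (Az); rewrite -{1}FA => -[j _ [y [Ay jy] fy]].
  by exists (j, exist _ y Ay).
pose z := fix z m := if m is m'.+1 then (sval (step (z m'))).2
                     else exist A a Aa.
exists (fun m => (sval (step (z m))).1), (fun m => sval (z m)).
by split=> // m; exact: (svalP (step (z m))).
Qed.

(** The first map applied on the outside is f_{b_{-1}}, and the others form a
    cylinder of the shifted code.  The index starts at 2, because at index 1
    the map f_{b_{-1}} is applied to its whole domain X_{b_{-1}}, which is not a
    cylinder of the shifted code. *)
Lemma cylinderS I b k :
  cylinder I b k.+2 = ifs_image I (b 0%N) (cylinder I (code_shift b) k.+1).
Proof.
by rewrite /cylinder /mkseq -[iota 0 k.+2]/(0%N :: iota 1 k.+1) (iotaDl 1 0)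
  [map _ (_ :: _)]/= -map_comp.
Qed.

Lemma cylinder1 I b : cylinder I b 1 = ifs_image I (b 0%N) (ifs_dom I (b 0%N)).
Proof. by []. Qed.

Lemma ifs_imageS I j A B : A `<=` B -> ifs_image I j A `<=` ifs_image I j B.
Proof.
by move=> AB _ [t [At jt] <-]; exists t => //; split=> //; exact: AB.
Qed.

Lemma cylinder_decr I b k : cylinder I b k.+2 `<=` cylinder I b k.+1.
Proof.
elim: k b => [|k IH] b; last first.
  by rewrite (cylinderS I b k.+1) (cylinderS I b k); exact/ifs_imageS/IH.
rewrite cylinderS !cylinder1 => _ [t [_ jt] <-].
by exists t => //; split.
Qed.

Lemma backward_orbit_cylinder I b x k :
  backward_orbit I b x -> cylinder I b k.+1 (x 0%N).
Proof.
elim: k b x => [|k IH] b x orb.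
  by rewrite cylinder1; have [dx <-] := orb 0%N; exists (x 1%N).
have [dx <-] := orb 0%N; rewrite cylinderS; exists (x 1%N) => //; split=> //.
exact: (IH _ _ (backward_orbit_shift orb)).
Qed.

Lemma ifs_image_compact I j B :
  compact [set: X] -> closed B -> compact (ifs_image I j B).
Proof.
move=> compX clB; apply: continuous_compact.
  by apply: (continuous_subspaceW (@subIsetr _ _ _)); exact: ifs_map_continuous.
by apply: (subclosed_compact _ compX) => //;
  apply: closedI => //; exact: ifs_dom_closed.
Qed.

Lemma cylinder_closed I b k : compact [set: X] -> closed (cylinder I b k.+1).
Proof.
move=> compX; elim: k b => [|k IH] b; rewrite ?cylinderS ?cylinder1;
  apply: (compact_closed (@metric_hausdorff _ X));
  apply: ifs_image_compact => //.
exact: ifs_dom_closed.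
Qed.

Lemma ifs_fiber_closed I j y :
  closed (ifs_dom I j `&` ifs_map I j @^-1` [set y]).
Proof.
(* The domain is closed, so closedness in its subspace topology is enough. *)
rewrite closed_setSI; last exact: ifs_dom_closed.
apply: (continuous_closedP _).1; first exact: ifs_map_continuous.
exact: (compact_closed (@metric_hausdorff _ X) (@compact_set1 _ y)).
Qed.

(** By nested compactness, the preimages of [y] that lie in the successive
    cylinders of the shifted code have a common element. *)
Lemma cylinders_preimage I b y : compact [set: X] ->
  (forall k, cylinder I b k.+1 y) ->
  exists t, [/\ ifs_dom I (b 0%N) t, ifs_map I (b 0%N) t = y &
                forall k, cylinder I (code_shift b) k.+1 t].
Proof.
move=> compX cyl.
pose C k := (ifs_dom I (b 0%N) `&` ifs_map I (b 0%N) @^-1` [set y])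
            `&` cylinder I (code_shift b) k.+1.
have clC k : closed (C k).
  by apply: closedI; [exact: ifs_fiber_closed|exact: cylinder_closed].
have [|||t Ct] := @nested_compact_bigcap_neq0 X C _ clC.
- exact: (subclosed_compact _ compX).
- by move=> k; apply: setIS; exact: cylinder_decr.
- by move=> k; have := cyl k.+1; rewrite cylinderS => -[t [ct dt] ft]; exists t.
exists t; have [[dt ft] _] := Ct 0%N Logic.I.
by split=> // k; have [] := Ct k Logic.I.
Qed.

Lemma code_backward_orbit I b y : compact [set: X] ->
  (forall k, cylinder I b k.+1 y) ->
  exists x, backward_orbit I b x /\ x 0%N = y.
Proof.
(* The m-th point is chosen in all cylinders of sh m, the m-th iterated shift
   of b. *)
move=> compX cyl; pose sh m : codeseq n := fun k => b (k + m)%N.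
pose P m t := forall k, cylinder I (sh m) k.+1 t.
have step m (z : {z : X | P m z}) : {t : {z : X | P m.+1 z} |
    ifs_dom I (b m) (sval t) /\ ifs_map I (b m) (sval t) = sval z}.
  apply: cid; case: z => z Pz /=.
  have [t [dt ft]] := cylinders_preimage compX Pz.
  have -> : code_shift (sh m) = sh m.+1.
    by apply/funext => k; rewrite /code_shift /sh addnS.
  by move=> Pt; exists (exist _ t Pt).
have P0 : P 0%N y.
  by move=> k; rewrite (_ : sh 0%N = b)//; apply/funext => i; rewrite /sh addn0.
pose z := fix z m : {z : X | P m z} :=
  if m is m'.+1 then sval (step m' (z m')) else exist _ y P0.
exists (fun m => sval (z m)); split=> // m; exact: (svalP (step m (z m))).
Qed.

Lemma local_code_space_backward_orbit I b : compact [set: X] ->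
  local_code_space I b <-> exists x, backward_orbit I b x.
Proof.
move=> compX; split=> [[y cyl]|[x orb]].
  by have [|x [orb _]] := @code_backward_orbit I b y compX;
    [move=> k; exact: cyl|exists x].
by exists (x 0%N) => -[//|k] _; exact: backward_orbit_cylinder.
Qed.

(** The starting points of backward orbits form an invariant set: a point of
    it is the image of the next point of its orbit, and a backward orbit can be
    extended at its start. *)
Lemma largest_invariant_backward_orbit I A : is_largest_invariant I A ->
  A = [set a | exists b x, backward_orbit I b x /\ x 0%N = a].
Proof.
move=> [FA maxA]; apply/seteqP; split=> [a|].
  exact: invariant_backward_orbit.
apply: maxA; apply/seteqP; split.
  move=> _ [j _ [_ [[b [x [orb <-]]] jx] <-]].
  by eexists; eexists; split; first exact: (backward_orbit_extend orb jx).
move=> _ [b [x [orb <-]]]; have [dx fx] := orb 0%N.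
exists (b 0%N) => //; exists (x 1%N) => //; split=> //.
by exists (code_shift b), (x \o S); split=> //; exact: backward_orbit_shift.
Qed.

Definition past_points (w : bisequence X n) : nat -> X :=
  fun m => pi_X (- m%:Z) w.

(** The set Omega: bisequences whose past symbols form a code in {1, ..., n}
    and whose points of nonpositive index form a backward orbit with this
    code. *)
Definition extended_space I : set (bisequence X n) :=
  [set w | exists b, pi_code w = code_incl b /\
                     backward_orbit I b (past_points w)].

(** A bisequence with prescribed past; its other coordinates, which
    [extended_space] does not constrain, get the symbol 0 and the point x_0. *)
Definition of_past b x : bisequence X n := fun k =>
  match k with
  | Posz _ => (x 0%N, ord0)
  | Negz m => (x m.+1, lift ord0 (b m))
  end.

Lemma past_points_of_past b x : past_points (of_past b x) = x.
Proof. by apply/funext => -[|m]; rewrite /past_points /pi_X ?oppr0 -?NegzE. Qed.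

Lemma pi_code_of_past b x : pi_code (of_past b x) = code_incl b.
Proof. by apply/funext => m; rewrite /pi_code -NegzE. Qed.

Lemma extended_space_of_past I b x :
  backward_orbit I b x -> extended_space I (of_past b x).
Proof. by exists b; rewrite pi_code_of_past past_points_of_past. Qed.

Lemma past_points_bishift_inv (w : bisequence X n) :
  past_points (bishift_inv w) = past_points w \o S.
Proof.
by apply/funext => m; rewrite /past_points /pi_X /bishift_inv /= -opprD addrC.
Qed.

Lemma pi_code_bishift_inv (w : bisequence X n) :
  pi_code (bishift_inv w) = pi_code w \o S.
Proof.
by apply/funext => m; rewrite /pi_code /bishift_inv /= -opprD addrC.
Qed.

Lemma extended_space_bishift_inv I w :
  extended_space I w -> extended_space I (bishift_inv w).
Proof.
move=> [b [wb orb]]; exists (code_shift b).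
rewrite pi_code_bishift_inv past_points_bishift_inv wb; split=> //.
exact: backward_orbit_shift.
Qed.

End BackwardOrbits.

Theorem theorem4 (R : realType) (X : metricType R) (n : nat)
    (I : localIFS X n) (A : set X)
    (compactX : compact [set: X]) (n_ge2 : (2 <= n)%N)
    (contrI : contractive I) (attrA : is_local_attractor I A) :
  exists Omega : set (bisequence X n),
    [/\ pi_code @` Omega = @code_incl n @` local_code_space I,
        pi_X 0 @` Omega = A,
        Omega !=set0,
        bishift_inv @` Omega `<=` Omega &
        forall w, Omega w -> exists z : X * codeseq n,
          [/\ prod_map (pi_X (- 1)) pi_code w = prod_code_incl z,
              skew_dom I z &
              (prod_map (pi_X 1) pi_code \o bishift_inv) w
                = prod_code_incl (skew_map I z)]].
Proof.
have [largestA [a Aa]] := attrA.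
have AE := largest_invariant_backward_orbit largestA.
exists (extended_space I); split.
- apply/seteqP; split=> [_ [w [b [-> orb]] <-]|_ [b lb <-]].
    exists b => //.
    by apply/(local_code_space_backward_orbit I b compactX);
      eexists; exact: orb.
  have [x orb] := (local_code_space_backward_orbit I b compactX).1 lb.
  exists (of_past b x); first exact: extended_space_of_past.
  exact: pi_code_of_past.
- rewrite AE; apply/seteqP; split=> [_ [w [b [_ orb]] <-]|_ [b [x [orb <-]]]].
    by exists b, (past_points w); rewrite /past_points oppr0.
  by exists (of_past b x) => //; exact: extended_space_of_past.
- move: Aa; rewrite AE => -[b [x [orb _]]].
  by exists (of_past b x); exact: extended_space_of_past.
- by move=> _ [w Ow <-]; exact: extended_space_bishift_inv.
- move=> w [b [wb orb]]; have [dx fx] := orb 0%N.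
  exists (past_points w 1%N, b); split=> //.
    by rewrite /prod_map wb.
  rewrite /= /prod_map pi_code_bishift_inv wb /skew_map /= fx.
  by rewrite /past_points /pi_X /bishift_inv subrr oppr0.
Qed.
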